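(* Let $D$ be a distortion function and let $Q$ be the probability measure on $\mathcal{B}((0,1))$ corresponding to $D$. The following are equivalent: (a) $D$ is convex. (b) $\varrho_Q$ is subadditive. (c) $\mathcal{L}_Q$ is a convex cone and $\varrho_Q$ is subadditive.
   Context: ''Increasing'' and ''positive'' are meant in the weak sense. $(\Omega,\mathcal{F},P)$ is a fixed probability space and $\mathcal{L}^0$ is the set of all real random variables on it. $\mathcal{B}((0,1))$ is the $\sigma$-field of Borel sets of $(0,1)$. For $X\in\mathcal{L}^0$, $F_X(x):=P[\{X\le x\}]$ is the distribution function, and $F_X^\leftarrow:(0,1)\to\mathbb{R}$, $F_X^\leftarrow(u):=\inf\{x\in\mathbb{R}\mid F_X(x)\ge u\}$, is the (lower) quantile function. A distortion function is an increasing, right-continuous function $D:[0,1]\to[0,1]$ with $D(0)=0$ and $\sup_{u\in(0,1)}D(u)=1$ (hence $D(1)=1$). The probability measure $Q$ on $\mathcal{B}((0,1))$ corresponding to $D$ is the unique one with $Q[(0,u]]=D(u)$ for all $u\in(0,1)$. $\mathcal{L}_Q:=\{X\in\mathcal{L}^0\mid\int_{(0,1)}(F_X^\leftarrow(u))^+\,dQ(u)<\infty\}$, and the quantile risk measure $\varrho_Q:\mathcal{L}_Q\to[-\infty,\infty)$ is $\varrho_Q[X]:=\int_{(0,1)}F_X^\leftarrow(u)\,dQ(u)$. $\varrho_Q$ is called subadditive if $\varrho_Q[X+Y]\le\varrho_Q[X]+\varrho_Q[Y]$ holds for all $X,Y\in\mathcal{L}_Q$ such that $X+Y\in\mathcal{L}_Q$.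 $\mathcal{L}_Q$ is a convex cone if $X+Y\in\mathcal{L}_Q$ and $aX\in\mathcal{L}_Q$ for all $X,Y\in\mathcal{L}_Q$ and all real $a\ge0$.
   Formalization: That (b) or (c) implies (a) is proved only when the probability space carries a random variable uniform on (0,1), i.e. is atomless; on a one-point space (b) and (c) hold for every D. That (a) implies (b) and (c) is proved on every probability space. *)

(* Defs.v *)
From mathcomp Require Import all_boot all_order all_algebra.
From mathcomp Require Import all_classical all_reals all_analysis.
From mathcomp Require Import measurable_realfun.
Set Implicit Arguments.
Unset Strict Implicit.
Unset Printing Implicit Defensive.
Import Order.TTheory GRing.Theory Num.Theory.
Import numFieldNormedType.Exports.
Local Open Scope classical_set_scope.
Local Open Scope ring_scope.

(* A function D : [0,1] -> [0,1] is represented by a function on all of R, of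
   which only the values on [0,1] matter. *)
Definition distortion (R : realType) (D : R -> R) : Prop :=
  [/\ forall u : R, u \in `[0, 1] -> D u \in `[0, 1],
      {in `[0, 1] &, {homo D : u v / u <= v}},
      forall u : R, u \in `[0, 1[ -> D v @[v --> u^'+] --> D u,
      D 0 = 0 &
      sup (D @` `]0, 1[) = 1].

(* A probability measure on the Borel sets of (0,1) is represented by a
   probability measure on the Borel sets of R carried by (0,1). *)
Definition corresponds (R : realType)
    (Q : probability (measurableTypeR R) R) (D : R -> R) : Prop :=
  Q `]0, 1[%classic = 1%E /\
  forall u : R, u \in `]0, 1[ -> Q `]0, u]%classic = (D u)%:E.

Section quantile_risk_measure.
Context (R : realType) (d : measure_display) (T : measurableType d)
  (P : probability T R) (Q : probability (measurableTypeR R) R).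
Implicit Types (X Y : {RV P >-> R}) (a u : R).

Definition quantile X u : R := inf [set x : R | (u%:E <= cdf X x)%E].

Definition in_LQ X : Prop :=
  (\int[Q]_(u in `]0%R, 1%R[) (Num.max (quantile X u) 0%R)%:E < +oo)%E.

(* The library integral is the difference of the integrals of the positive and
   of the negative part, so that under in_LQ it lies in [-oo, +oo[. *)
Definition quantile_risk X : \bar R :=
  (\int[Q]_(u in `]0%R, 1%R[) (quantile X u)%:E)%E.

Definition subadditive_risk : Prop :=
  forall X Y, in_LQ X -> in_LQ Y -> in_LQ (X \+ Y) ->
    (quantile_risk (X \+ Y)%R <= quantile_risk X + quantile_risk Y)%E.

Definition LQ_convex_cone : Prop :=
  (forall X Y, in_LQ X -> in_LQ Y -> in_LQ (X \+ Y)) /\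
  (forall a X, 0 <= a -> in_LQ X -> in_LQ (a \o* X)).

End quantile_risk_measure.

(* The probability space carries a random variable that is uniformly
   distributed on (0,1); equivalently, it is atomless.  Without this, the
   subadditivity of the quantile risk measure does not force D to be convex:
   on a one-point space every quantile risk measure is additive. *)
Definition supports_uniform (R : realType) (d : measure_display)
    (T : measurableType d) (P : probability T R) : Prop :=
  exists U : {RV P >-> R}, forall u : R, u \in `[0, 1] -> cdf U u = u%:E.

(* Main.v *)
(* For X >= 0 with tail S_X(x) = P(X > x), the layer-cake formula under Q turns
   the risk into the integral over [0, +oo[ of psi(S_X(x)), where
   psi(p) = 1 - D(1 - p).  When D is convex, psi is concave and increasing with
   psi(0) = 0, hence is a limit from below of positive combinations of the
   functions p |-> min(p, t).  The integral of min(S_X, t) is an expected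
   shortfall, subadditive in X by the Rockafellar-Uryasev formula.  This gives
   subadditivity for nonnegative variables; the general case follows by applying
   it to max(X + n, 0) and max(Y + n, 0) and letting n go to infinity.

   Conversely, with U uniform and m = (x + y) / 2 for x <= y, subadditivity for
   the indicators of {U > m} and {x < U <= m} \/ {U > y} is the midpoint
   convexity of D, and a bounded midpoint convex function is convex. *)
Require Import Defs.
From mathcomp Require Import all_boot all_order all_algebra.
From mathcomp Require Import all_classical all_reals all_analysis.
From mathcomp Require Import measurable_realfun lra ring.
Set Implicit Arguments.
Unset Strict Implicit.
Unset Printing Implicit Defensive.
Import Order.TTheory GRing.Theory Num.Theory.
Import numFieldNormedType.Exports.
Local Open Scope classical_set_scope.
Local Open Scope ring_scope.

(** * Tails and quantiles *)

Section tail.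
Context (R : realType) (d : measure_display) (T : measurableType d)
  (P : probability T R).
Implicit Types (X Y : {RV P >-> R}) (x u : R).

Definition tail X x : R := fine (ccdf X x).

Lemma ccdfE X x : ccdf X x = (tail X x)%:E.
Proof. by rewrite fineK// fin_num_measure. Qed.

Lemma cdfE X x : cdf X x = (1 - tail X x)%:E.
Proof. by rewrite cdf_1_ccdf ccdfE EFinB. Qed.

Lemma tail_ge0 X x : 0 <= tail X x.
Proof. by rewrite fine_ge0. Qed.

Lemma tail_le1 X x : tail X x <= 1.
Proof. by rewrite -lee_fin -ccdfE; exact: probability_le1. Qed.

Lemma tail_noninc X x y : x <= y -> tail X y <= tail X x.
Proof. by move=> xy; rewrite -lee_fin -!ccdfE; exact: ccdf_nonincreasing. Qed.

Lemma measurable_tail X : measurable_fun [set: R] (tail X).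
Proof. by apply: measurableT_comp => //; exact: ccdf_measurable. Qed.

(** A Galois connection: for 0 < u < 1 the defining set is nonempty and bounded below, and
    right-continuity of the ccdf puts the infimum in it. Later facts about quantiles are read off
    from this equivalence. *)
Lemma quantile_le X u x : 0 < u < 1 ->
  (quantile X u <= x) = (tail X x <= 1 - u).
Proof.
move=> /andP[u0 u1].
have inE r : (u%:E <= cdf X r)%E = (tail X r <= 1 - u).
  by rewrite cdfE lee_fin; apply/idP/idP; lra.
rewrite /quantile.
have -> : [set r | (u%:E <= cdf X r)%E] = [set r | tail X r <= 1 - u].
  by apply/seteqP; split => r /=; rewrite inE.
set A := [set r | _].
have [b tb] : exists b, 1 - u < tail X b.
  have /fine_cvg /cvgr_gt/(_ (1 - u)) : ccdf X r @[r --> -oo] --> 1%:E.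
    exact: cvg_ccdfNy1.
  by rewrite gtrBl => /(_ u0)/filter_ex[b tb]; exists b.
have [a ta] : exists a, tail X a < 1 - u.
  have /fine_cvg /cvgr_lt/(_ (1 - u)) : ccdf X r @[r --> +oo] --> 0%:E.
    exact: cvg_ccdfy0.
  by rewrite subr_gt0 => /(_ u1)/filter_ex[a ta]; exists a.
have lbA : lbound A b.
  move=> r; rewrite /A /= => Ar; rewrite leNgt; apply/negP.
  by move=> /ltW/(tail_noninc X); lra.
have hA : has_inf A by split; [exists a; exact: ltW|exists b].
apply/idP/idP => [infx|tx]; last by apply: ge_inf => //; exists b.
(* A tail above 1 - u at the infimum would stay above it slightly to the right, where [inf_adherent]
   finds a point of [A]. *)
apply: (le_trans (tail_noninc X infx)); rewrite leNgt; apply/negP => tinf.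
have /fine_cvg /cvgr_gt/(_ _ tinf) :
    ccdf X r @[r --> (inf A)^'+] --> (tail X (inf A))%:E.
  by rewrite -ccdfE; exact: ccdf_right_continuous.
move=> [e /= e0 He].
have [r Ar re] := inf_adherent e0 hA.
have := ge_inf (ex_intro _ b lbA) Ar; rewrite le_eqVlt => /orP[/eqP ir|ir].
  by move: Ar; rewrite /A /= -ir leNgt tinf.
have := He r; rewrite /ball/= ltr0_norm ?subr_lt0// opprB ltrBlDl => /(_ re ir).
by rewrite -/(tail X r) ltNge; move: Ar; rewrite /A /= => ->.
Qed.
End tail.

Section quantile_integral.
Context (R : realType) (d : measure_display) (T : measurableType d)
  (P : probability T R).
Implicit Types (X Y : {RV P >-> R}) (x u : R).

Lemma quantile_lt X u x : 0 < u < 1 ->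
  (x < quantile X u) = (1 - u < tail X x).
Proof. by move=> u01; rewrite !ltNge quantile_le. Qed.

Lemma measurable_quantile X :
  measurable_fun (`]0, 1[%classic : set R) (quantile X).
Proof.
move=> m01; apply: (measurability (@RGenOInfty.G R)) => //.
  exact: RGenOInfty.measurableE.
move=> /= _ [_] [x] -> <-.
have -> : `]0, 1[ `&` quantile X @^-1` `]x, +oo[ =
    `]0, 1[ `&` `]1 - tail X x, +oo[%classic.
  apply/seteqP; split => u /=; rewrite !in_itv/= !andbT => -[u01].
    by rewrite quantile_lt// => ?; split=> //; lra.
  by rewrite quantile_lt// => ?; split=> //; lra.
exact: measurableI.
Qed.

Lemma quantile_ge X u x : 0 < u < 1 -> (forall y, y < x -> 1 - u < tail X y) ->
  x <= quantile X u.
Proof.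
move=> u01 Hx; rewrite leNgt; apply/negP => qx.
by have := lexx (quantile X u); rewrite quantile_le// leNgt Hx.
Qed.

Lemma tail_lt0 X x : (forall w, 0 <= X w) -> x < 0 -> tail X x = 1.
Proof.
move=> X0 x0; rewrite /tail /ccdf /distribution /pushforward.
rewrite (_ : _ @^-1` _ = setT) ?probability_setT//.
by apply/seteqP; split => // w _ /=; rewrite in_itv/= andbT (lt_le_trans x0).
Qed.

Lemma quantile_ge0 X u : (forall w, 0 <= X w) -> 0 < u < 1 -> 0 <= quantile X u.
Proof.
by move=> X0 u01; apply: quantile_ge => // y y0; rewrite tail_lt0//; lra.
Qed.

Lemma tail_le X Y x : (forall w, X w <= Y w) -> tail X x <= tail Y x.
Proof.
move=> XY; rewrite -lee_fin -!ccdfE /ccdf /distribution /pushforward.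
apply: le_measure; rewrite ?inE; [exact: measurable_funPTI..|].
by move=> w /=; rewrite !in_itv/= !andbT => /lt_le_trans; apply.
Qed.

Lemma quantile_mono X Y u : 0 < u < 1 -> (forall w, X w <= Y w) ->
  quantile X u <= quantile Y u.
Proof.
move=> u01 XY; rewrite quantile_le//; apply: le_trans (tail_le _ XY) _.
by rewrite -quantile_le.
Qed.

End quantile_integral.

(** * The layer-cake formula under Q *)

Section layer_cake.
Context (R : realType) (d : measure_display) (T : measurableType d)
  (P : probability T R) (D : R -> R) (Q : probability (measurableTypeR R) R).
Hypotheses (hD : distortion D) (hQ : corresponds Q D).
Implicit Types (X Y : {RV P >-> R}) (x u : R).

Lemma distortion1 : D 1 = 1.
Proof.
have [D01 Dmono _ D0 Dsup] := hD.
apply/eqP; rewrite eq_le; apply/andP; split.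
  by have := D01 1; rewrite !in_itv/= ler01 lexx/= => /(_ isT)/andP[].
rewrite -[leLHS]Dsup; apply: ge_sup.
  by exists (D 2^-1), 2^-1 => //=; rewrite in_itv/=; apply/andP; split; lra.
move=> _ [u /= + <-]; rewrite in_itv/= => /andP[u0 u1].
by apply: Dmono; rewrite ?in_itv/= ?(ltW u0) ?(ltW u1) ?ler01 ?lexx.
Qed.

(** [corresponds] speaks of u inside ]0, 1[ only; u = 0 follows from the total mass and D 0 = 0, u =
    1 from the empty interval and D 1 = 1. *)
Lemma Q_tail u : 0 <= u <= 1 -> Q `]u, 1[%classic = (1 - D u)%:E.
Proof.
have [_ _ _ D0 _] := hD; have [Q1 Qu] := hQ.
move=> /andP[]; rewrite le_eqVlt => /orP[/eqP <- _|u0].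
  by rewrite D0 subr0.
rewrite le_eqVlt => /orP[/eqP ->|u1].
  by rewrite distortion1 subrr set_itvoo0 measure0.
have : (Q `]0%R, u]%classic + Q `]u, 1%R[%classic = 1)%E.
  have e : (`]0, 1[ = `]0, u] `|` `]u, 1[ :> set R)%classic.
    by rewrite -itv_bndbnd_setU ?bnd_simp ?(ltW u0).
  rewrite -Q1 [in RHS]e measureU//.
  apply/seteqP; split => // x /=; rewrite !in_itv/= => -[/andP[_ +] /andP[+ _]].
  by move=> /le_lt_trans h /h; rewrite ltxx.
rewrite Qu ?in_itv/= ?u0 ?u1// => /(congr1 (fun z => z - (D u)%:E)%E).
by rewrite addeAC subee// add0e EFinB.
Qed.

(** As a random variable under [Q], the quantile exceeds x exactly on ]1 - tail X x, 1[, whose mass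
    [Q_tail] gives. *)
Lemma quantile_layer_cake X : (forall w, 0 <= X w) ->
  (\int[Q]_(u in `]0%R, 1%R[) (quantile X u)%:E =
   \int[lebesgue_measure]_(x in `[0%R, +oo[) (1 - D (1 - tail X x))%R%:E)%E.
Proof.
move=> X0.
(* Extension by 0 outside ]0, 1[ adds no point to the events {q > x} with x >= 0. *)
have mq : measurable_fun [set: measurableTypeR R] (quantile X \_ `]0, 1[).
  by apply/(measurable_restrictT _ _).1 => //; exact: measurable_quantile.
pose q : {RV Q >-> R} := @mfun_Sub _ _ (measurableTypeR R) R _ (mem_set mq).
have q0 u : 0 <= q u.
  rewrite /q/= /patch; case: ifPn => //; rewrite inE/= in_itv/=.
  exact: quantile_ge0.
have := @ge0_expectation_ccdf _ (measurableTypeR R) R Q q q0.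
rewrite expectation_def.
have -> : (\int[Q]_w (q w)%:E = \int[Q]_(u in `]0%R, 1%R[) (quantile X u)%:E)%E.
  rewrite [RHS]integral_mkcond; apply: eq_integral => u _.
  by rewrite /= /patch; case: ifP.
move=> ->; apply: eq_integral => x; rewrite inE/= in_itv/= andbT => x0.
rewrite /ccdf /distribution /pushforward -Q_tail; last first.
  by rewrite subr_ge0 tail_le1 gerBl tail_ge0.
congr (Q _); apply/seteqP; split => u /=; rewrite !in_itv/= andbT.
  rewrite /patch; case: ifPn => [|_]; last by rewrite ltNge x0.
  by rewrite inE/= in_itv/= => u01; rewrite quantile_lt// => ?; lra.
move=> /andP[u0 u1].
have u01 : 0 < u < 1.
  by rewrite u1 andbT (le_lt_trans _ u0)// subr_ge0 tail_le1.
rewrite /patch mem_set/=; last by rewrite in_itv.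
by rewrite quantile_lt//; lra.
Qed.

End layer_cake.

(** * Expected shortfall *)

Section min_tail.
Context (R : realType) (d : measure_display) (T : measurableType d)
  (P : probability T R).
Implicit Types (X Y : {RV P >-> R}) (c t x : R).

Definition cutoff X c : {RV P >-> R} :=
  mfun_Sub (mem_set
    (measurable_maxr (@measurable_funPT _ _ _ _ X) (measurable_cst c))).

Lemma cutoffE X c w : cutoff X c w = Num.max (X w) c.
Proof. by []. Qed.

Lemma tail_cutoff X c x : tail (cutoff X c) x = if x < c then 1 else tail X x.
Proof.
rewrite /tail /ccdf /distribution /pushforward; case: ltP => xc.
  rewrite (_ : _ @^-1` _ = setT) ?probability_setT//.
  by apply/seteqP; split => // w _ /=; rewrite in_itv/= andbT lt_max xc orbT.
congr (fine (P _)); apply/seteqP; split => w /=; rewrite !in_itv/= !andbT.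
  by rewrite lt_max (ltNge x c) xc orbF.
by rewrite lt_max => ->.
Qed.

Local Notation mu := (@lebesgue_measure R).

Lemma integral_step c t : 0 <= c -> 0 <= t ->
  (\int[mu]_(x in `[0%R, +oo[) (t * \1_(`[0%R, c[%classic : set R) x)%R%:E =
   (t * c)%:E)%E.
Proof.
move=> c0 t0.
under eq_integral do rewrite EFinM.
rewrite ge0_integralZl//; last first.
  by apply/measurable_EFinP; apply: measurable_indic.
rewrite integral_indic// (_ : _ `&` _ = `[0, c[%classic); last first.
  by apply/seteqP; split => x /=; rewrite !in_itv/= ?andbT;
    [case|move=> /[dup] /andP[-> _] ->].
have muc : mu `[0, c[%classic = c%:E.
  rewrite lebesgue_measure_itv/= lte_fin oppr0 addr0.
  by case: ltP c0 => // c0' c0; congr EFin; lra.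
by rewrite [X in (_ * X)%E](_ : _ = c%:E)// -EFinM.
Qed.

(** For [X] nonnegative and 0 < t <= 1 this is t times the expected shortfall, that is, the Lebesgue
    integral of the quantile over the levels ]1 - t, 1[. *)
Definition min_tail t X : \bar R :=
  (\int[mu]_(x in `[0%R, +oo[) (Num.min (tail X x) t)%:E)%E.

Lemma measurable_min_tail t X (A : set R) :
  measurable_fun A (fun x => (Num.min (tail X x) t)%:E).
Proof.
apply/measurable_EFinP/measurable_minr => //.
by apply: measurable_funTS; exact: measurable_tail.
Qed.

Lemma min_tail_ge0 t X : 0 <= t -> (0 <= min_tail t X)%E.
Proof.
by move=> t0; apply: integral_ge0 => x _; rewrite lee_fin le_min tail_ge0.
Qed.

(** Spreading (1 - t) c as a step over [0, c[ reduces the comparison with an expectation to one of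
    integrands. *)
Let min_tailD c t X : 0 <= c -> 0 <= t <= 1 ->
  (min_tail t X + ((1 - t) * c)%:E = \int[mu]_(x in `[0%R, +oo[)
    (Num.min (tail X x) t + (1 - t) * \1_(`[0%R, c[%classic : set R) x)%R%:E)%E.
Proof.
move=> c0 /andP[t0 t1].
rewrite -integral_step ?subr_ge0// -ge0_integralD//.
- by move=> x _; rewrite lee_fin le_min tail_ge0.
- exact: measurable_min_tail.
- by move=> x _; rewrite lee_fin mulr_ge0// subr_ge0.
- apply/measurable_EFinP/measurable_funM => //; exact: measurable_indic.
Qed.

(** Below c the cutoff has tail 1, which dominates min(tail, t) + (1 - t); from c on, min(tail, t)
    is at most the tail. *)
Lemma min_tail_le_expectation c t X : 0 <= c -> 0 <= t <= 1 ->
  (min_tail t X + ((1 - t) * c)%:E <= 'E_P[cutoff X c])%E.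
Proof.
move=> c0 t01; rewrite min_tailD// ge0_expectation_ccdf; last first.
  by move=> w; rewrite cutoffE le_max c0 orbT.
have /andP[t0 t1] := t01.
apply: ge0_le_integral => //.
- move=> x _; rewrite lee_fin addr_ge0// ?mulr_ge0// ?subr_ge0//.
  by rewrite le_min tail_ge0.
- apply/measurable_EFinP/measurable_funD; last first.
    by apply: measurable_funM => //; exact: measurable_indic.
  apply: measurable_minr => //; apply: measurable_funTS; exact: measurable_tail.
- by apply: measurable_funTS; exact: ccdf_measurable.
move=> x /=; rewrite in_itv/= andbT => x0.
rewrite ccdfE lee_fin tail_cutoff indicE mem_setE in_itv/= x0/=.
by case: ltP => _; rewrite /= minEle; case: ifP; have := tail_le1 X x; lra.
Qed.

(** If the tail crosses the level t exactly at c, both pointwise bounds are equalities: the minimum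
    is t below c and the tail from c on. *)
Lemma min_tail_eq_expectation c t X : 0 <= c -> 0 <= t <= 1 ->
  (forall x, 0 <= x -> (c <= x) = (tail X x <= t)) ->
  (min_tail t X + ((1 - t) * c)%:E = 'E_P[cutoff X c])%E.
Proof.
move=> c0 t01 ct; rewrite min_tailD// ge0_expectation_ccdf; last first.
  by move=> w; rewrite cutoffE le_max c0 orbT.
apply: eq_integral => x; rewrite inE/= in_itv/= andbT => x0.
rewrite ccdfE tail_cutoff indicE mem_setE in_itv/= x0/= ltNge ct//.
by rewrite minEle; case: ifP => _ /=; rewrite ?mulr0 ?mulr1 ?addr0// addrC subrK.
Qed.

(* The quantile at level 1 - t realises the equality case of the bound
   int min(tail X, t) <= E[max(X, c)] - (1 - t) c, the Rockafellar-Uryasev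
   formula for the expected shortfall. *)
Lemma min_tail_subadditive t X Y : 0 < t <= 1 ->
    (forall w, 0 <= X w) -> (forall w, 0 <= Y w) ->
  (min_tail t (X \+ Y)%R <= min_tail t X + min_tail t Y)%E.
Proof.
move=> /andP[t0 t1] X0 Y0.
have t01 : 0 <= t <= 1 by rewrite (ltW t0).
have ex (Z : {RV P >-> R}) : (forall w, 0 <= Z w) ->
    exists2 c, 0 <= c & (min_tail t Z + ((1 - t) * c)%:E = 'E_P[cutoff Z c])%E.
  (* For t = 1 the level 1 - t is 0, outside the open range of [quantile_le]; there c = 0 works,
     since tails are at most 1. *)
  move=> Z0; move: t1; rewrite le_eqVlt => /orP[/eqP t1|t1].
    exists 0 => //; apply: min_tail_eq_expectation => // x ->.
    by rewrite t1 tail_le1.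
  have h : 0 < 1 - t < 1 by apply/andP; split; lra.
  have q0 := quantile_ge0 Z0 h.
  exists (quantile Z (1 - t)) => //.
  apply: min_tail_eq_expectation => // x _.
  by rewrite quantile_le// opprB addrC subrK.
have [a a0 Xa] := ex X X0; have [b b0 Yb] := ex Y Y0.
have ab0 : 0 <= a + b by exact: addr_ge0.
(* The cutoff a + b need not be optimal for X + Y, but the upper bound holds at any c >= 0; then
   max(X + Y, a + b) <= max(X, a) + max(Y, b). *)
have : (min_tail t (X \+ Y)%R + ((1 - t) * (a + b))%:E <=
   (min_tail t X + min_tail t Y) + ((1 - t) * (a + b))%:E)%E.
  apply: (le_trans (min_tail_le_expectation _ ab0 t01)).
  rewrite mulrDr EFinD addeACA Xa Yb !expectation_def -ge0_integralD//.
  - apply: ge0_le_integral => //.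
    + by move=> w _; rewrite lee_fin cutoffE le_max ab0 orbT.
    + by apply/measurable_EFinP.
    + by apply: emeasurable_funD; apply/measurable_EFinP.
    move=> w _; rewrite !cutoffE -EFinD lee_fin ge_max.
    by rewrite !lerD// le_max lexx ?orbT.
  - by move=> w _; rewrite lee_fin cutoffE le_max a0 orbT.
  - by apply/measurable_EFinP.
  - by move=> w _; rewrite lee_fin cutoffE le_max b0 orbT.
  - by apply/measurable_EFinP.
by rewrite leeD2rE.
Qed.

End min_tail.

(** * Concave distortions of the tail *)

Section concave_approximation.
Context (R : realType) (f : R -> R).
(** Concavity is the chord inequality cleared of denominators, so that a = b is allowed. *)
Hypotheses (f0 : f 0 = 0)
  (f_nd : forall p q, 0 <= p -> p <= q -> q <= 1 -> f p <= f q)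
  (f_concave : forall a p b, 0 <= a -> a <= p -> p <= b -> b <= 1 ->
    f a * (b - p) + f b * (p - a) <= f p * (b - a)).
Implicit Types (p : R).

(** The sum is the piecewise linear interpolant of [f] on the grid of mesh 1/(N+1). Concavity puts
    it below [f] and makes the slopes decrease; monotonicity puts it above [f] shifted by one
    mesh. *)
Lemma concave_min_approx N : exists w : nat -> R,
  (forall j, 0 <= w j) /\ forall p, 0 <= p <= 1 ->
    f (Num.max (p - N.+1%:R^-1) 0) <=
      \sum_(j < N.+1) w j * Num.min p (j.+1%:R / N.+1%:R) <= f p.
Proof.
move nE : (N.+1%:R^-1) => e.
pose t j : R := j%:R * e.
have t0 : t 0%N = 0 by rewrite /t mul0r.
have t1 : t N.+1 = 1 by rewrite /t -nE divff// pnatr_eq0.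
have n0 : 0 < e by rewrite -nE invr_gt0.
have tS j : t j.+1 = t j + e by rewrite /t -natr1 mulrDl mul1r.
have tle j : (j <= N.+1)%N -> 0 <= t j <= 1.
  by move=> jN; rewrite mulr_ge0 ?(ltW n0)//= /t -nE ler_pdivrMr// mul1r ler_nat.
pose s j := N.+1%:R * (f (t j.+1) - f (t j)).
have sE j : f (t j.+1) - f (t j) = s j * e.
  by rewrite /s -nE mulrAC divff ?mul1r// pnatr_eq0.
have s_ge0 j : (j < N.+1)%N -> 0 <= s j.
  move=> jN; rewrite mulr_ge0// subr_ge0.
  have /andP[? ?] := tle _ (ltnW jN); have /andP[? ?] := tle _ jN.
  by apply: f_nd => //; rewrite tS lerDl ltW.
have s_noninc j : (j.+1 < N.+1)%N -> s j.+1 <= s j.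
  move=> jN; rewrite ler_pM2l//.
  have /andP[tj0 _] := tle _ (ltnW (ltnW jN)); have /andP[_ tj1] := tle _ jN.
  have h0 : t j <= t j.+1 by rewrite tS lerDl ltW.
  have h1 : t j.+1 <= t j.+2 by rewrite (tS j.+1) lerDl ltW.
  have := @f_concave (t j) (t j.+1) (t j.+2) tj0 h0 h1 tj1.
  rewrite (_ : t j.+2 - t j.+1 = e); last by rewrite (tS j.+1) addrC addKr.
  rewrite (_ : t j.+1 - t j = e); last by rewrite (tS j) addrC addKr.
  rewrite (_ : t j.+2 - t j = 2 * e); last by rewrite (tS j.+1) tS; lra.
  rewrite mulrA -mulrDl ler_pM2r//.
  by lra.
(* The weight of min(p, t) at a node t is the drop of slope there; the slope beyond the last node 1
   counts as 0. *)
pose w j := if (j < N)%N then s j - s j.+1 else if j == N then s N else 0.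
exists w; split=> [j|p /andP[p0 p1]].
  rewrite /w; case: ifP => [jN|_]; first by rewrite subr_ge0 s_noninc.
  by case: ifP => // _; exact: s_ge0.
(* Summation by parts turns slope drops at nodes into slopes times the part of each cell below p. *)
have -> : \sum_(j < N.+1) w j * Num.min p (j.+1%:R * e) =
    \sum_(j < N.+1) s j * (Num.min p (t j.+1) - Num.min p (t j)).
  have abel M (m : nat -> R) : m 0%N = 0 ->
      \sum_(j < M.+1) s j * (m j.+1 - m j) =
      \sum_(j < M) (s j - s j.+1) * m j.+1 + s M * m M.+1.
    move=> m0; elim: M => [|M IH].
      by rewrite big_ord_recr !big_ord0/= m0 subr0.
    by rewrite big_ord_recr/= IH [in RHS]big_ord_recr/=; ring.
  rewrite (abel _ (fun j => Num.min p (t j))); last by rewrite t0; apply/min_idPr.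
  rewrite big_ord_recr/= /w ltnn eqxx; congr (_ + _).
  by apply: eq_bigr => j _; rewrite ltn_ord.
(* Splitting [f] into increments over the cells clipped at q lets both bounds be checked cell by
   cell. *)
have tele q : 0 <= q -> q <= 1 -> f q =
    \sum_(j < N.+1) (f (Num.min q (t j.+1)) - f (Num.min q (t j))).
  move=> q0 q1.
  rewrite -(big_mkord xpredT (fun j => f (Num.min q (t j.+1)) - f (Num.min q (t j)))).
  rewrite telescope_sumr// t0 t1 (min_idPl _)// (_ : Num.min q 0 = 0) ?f0 ?subr0//.
  exact/min_idPr.
apply/andP; split.
  rewrite tele; last 2 first.
    by rewrite le_max lexx orbT.
    by rewrite ge_max ler01 andbT; lra.
  apply: ler_sum => j _.
  have /andP[tj0 tj1] := tle _ (ltnW (ltn_ord j)).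
  have /andP[tSj0 tSj1] := tle _ (ltn_ord j).
  set q := Num.max _ _.
  have q0 : 0 <= q by rewrite le_max lexx orbT.
  have qp : q <= p by rewrite ge_max p0 andbT; lra.
  have [tp|pt] := leP (t j.+1) p.
    rewrite (_ : Num.min p (t j) = t j); last first.
      by apply/min_idPr; rewrite (le_trans _ tp)// tS lerDl ltW.
    rewrite [in leRHS]tS [t j + _ - _]addrAC subrr add0r -sE.
    have [h|h] := leP q (t j).
      rewrite (min_idPl _); last by rewrite tS; lra.
      rewrite subrr subr_ge0.
      by apply: f_nd => //; rewrite tS; lra.
    rewrite lerD2r; apply: f_nd => //; last by rewrite ge_min lexx orbT.
    by rewrite le_min q0.
  (* Here p lies before the right end of the cell, so moving back by one mesh leaves the cell, and
     the increment of [f] is 0. *)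
  have qt : q <= t j.
    by rewrite /q ge_max tj0 andbT; move: pt; rewrite tS; lra.
  rewrite (min_idPl _); last by rewrite tS; lra.
  rewrite (min_idPl qt) subrr mulr_ge0 ?s_ge0// subr_ge0.
  by rewrite ge_min lexx.
rewrite [leRHS]tele//; apply: ler_sum => j _.
have /andP[tj0 tj1] := tle _ (ltnW (ltn_ord j)).
have /andP[tSj0 tSj1] := tle _ (ltn_ord j).
have [tp|pt] := leP (t j.+1) p.
  rewrite (_ : Num.min p (t j) = t j); last first.
    by apply/min_idPr; rewrite (le_trans _ tp)// tS lerDl ltW.
  by rewrite sE tS [t j + _ - _]addrAC subrr add0r.
have [tp|pt'] := leP (t j) p; last by rewrite !subrr mulr0.
(* This is the cell that contains p: its chord lies below [f]. *)
have := f_concave tj0 tp (ltW pt) tSj1.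
have -> : t j.+1 - p = e - (p - t j) by rewrite tS; lra.
have -> : t j.+1 - t j = e by rewrite tS; lra.
move=> h; rewrite -(ler_pM2r n0) mulrAC -sE; lra.
Qed.

End concave_approximation.

Section concave_tail.
Context (R : realType) (d : measure_display) (T : measurableType d)
  (P : probability T R) (f : R -> R).
(** [f_lc] is left-continuity along the shifts in the lower bound of [concave_min_approx]; it makes
    the interpolants converge to [f]. *)
Hypotheses (f0 : f 0 = 0)
  (f_nd : forall p q, 0 <= p -> p <= q -> q <= 1 -> f p <= f q)
  (f_concave : forall a p b, 0 <= a -> a <= p -> p <= b -> b <= 1 ->
    f a * (b - p) + f b * (p - a) <= f p * (b - a))
  (f_lc : forall p, 0 <= p <= 1 ->
    f (Num.max (p - N.+1%:R^-1) 0) @[N --> \oo] --> f p).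
Implicit Types (X Y : {RV P >-> R}).
Local Notation mu := (@lebesgue_measure R).

Lemma measurable_concave_tail X (A : set R) :
  measurable A -> measurable_fun A (fun x => f (tail X x)).
Proof.
move=> mA; apply: nonincreasing_measurable => // x y xy.
by apply: f_nd; rewrite ?tail_ge0 ?tail_le1 ?tail_noninc.
Qed.

(** Each interpolant inherits subadditivity from [min_tail] and lies below [f], which bounds its
    integral uniformly in N. The grids are not nested, so the limit is taken by Fatou rather than by
    monotone convergence. *)
Lemma concave_tail_subadditive X Y :
    (forall w, 0 <= X w) -> (forall w, 0 <= Y w) ->
  (\int[mu]_(x in `[0%R, +oo[) (f (tail ((X \+ Y)%R : {RV P >-> R}) x))%:E <=
   \int[mu]_(x in `[0%R, +oo[) (f (tail X x))%:E +
   \int[mu]_(x in `[0%R, +oo[) (f (tail Y x))%:E)%E.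
Proof.
move=> X0 Y0; set W : {RV P >-> R} := (X \+ Y)%R.
have /choice[w Hw] := concave_min_approx f0 f_nd f_concave.
have w0 N j : 0 <= w N j by have [] := Hw N.
pose t (N j : nat) : R := j.+1%:R / N.+1%:R.
have t0 N j : 0 < t N j by rewrite divr_gt0.
pose g N (Z : {RV P >-> R}) x :=
  (\sum_(j < N.+1) (w N j)%:E * (Num.min (tail Z x) (t N j))%:E)%E.
have gE N Z x : g N Z x =
    (\sum_(j < N.+1) w N j * Num.min (tail Z x) (t N j))%R%:E.
  by rewrite -sumEFin; apply: eq_bigr => j _; rewrite EFinM.
have tail01 (Z : {RV P >-> R}) x : 0 <= tail Z x <= 1 by rewrite tail_ge0 tail_le1.
have g_le N Z x : (g N Z x <= (f (tail Z x))%:E)%E.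
  by rewrite gE lee_fin; have [_ /(_ _ (tail01 Z x))/andP[]] := Hw N.
have g_ge0 N Z x : (0 <= g N Z x)%E.
  apply: sume_ge0 => j _; rewrite -EFinM lee_fin mulr_ge0//.
  by rewrite le_min tail_ge0 ltW.
have mg N Z : measurable_fun (`[0, +oo[%classic : set R) (g N Z).
  apply: emeasurable_sum => j; apply: emeasurable_funM => //.
  exact: measurable_min_tail.
have intg N Z : (\int[mu]_(x in `[0%R, +oo[) g N Z x =
    \sum_(j < N.+1) (w N j)%:E * min_tail (t N j) Z)%E.
  rewrite ge0_integral_sum//.
  - apply: eq_bigr => j _; rewrite ge0_integralZl//.
    + exact: measurable_min_tail.
    + by move=> x _; rewrite lee_fin le_min tail_ge0 ltW.
    + by rewrite lee_fin.
  - move=> j; apply: emeasurable_funM => //; exact: measurable_min_tail.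
  - by move=> j x _; rewrite mule_ge0 ?lee_fin ?w0 ?le_min ?tail_ge0 ?ltW.
have intg_le N Z : (\int[mu]_(x in `[0%R, +oo[) g N Z x <=
    \int[mu]_(x in `[0%R, +oo[) (f (tail Z x))%:E)%E.
  apply: ge0_le_integral => //; first exact: mg.
  by apply/measurable_EFinP; exact: measurable_concave_tail.
have bound N : (\int[mu]_(x in `[0%R, +oo[) g N W x <=
   \int[mu]_(x in `[0%R, +oo[) (f (tail X x))%:E +
   \int[mu]_(x in `[0%R, +oo[) (f (tail Y x))%:E)%E.
  apply: le_trans (leeD (intg_le N X) (intg_le N Y)).
  rewrite !intg -big_split/=; apply: lee_sum => j _.
  rewrite -ge0_muleDr; [|by apply/min_tail_ge0/ltW..].
  apply: lee_wpmul2l; first by rewrite lee_fin.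
  apply: min_tail_subadditive => //; rewrite t0/= ler_pdivrMr// mul1r ler_nat.
  exact: ltn_ord.
have cvgg x : g N W x @[N --> \oo] --> (f (tail W x))%:E.
  apply: (@squeeze_cvge _ _ _ _
      (fun N => (f (Num.max (tail W x - N.+1%:R^-1) 0))%:E) _
      (fun=> (f (tail W x))%:E)) => //.
  - apply: nearW => N; rewrite g_le andbT gE lee_fin.
    by have [_ /(_ _ (tail01 W x))/andP[]] := Hw N.
  - by apply/fine_cvgP; split; [exact: nearW|exact: f_lc (tail01 W x)].
  - exact: cvg_cst.
under eq_integral => x _ do rewrite -(cvg_limn_einf_sup (cvgg x)).1.
apply: le_trans; first by apply: fatou => // N; exact: mg.
rewrite limn_einf_lim; apply: lime_le; first exact: is_cvg_einfs.
apply: nearW => N; apply: le_trans (bound N).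
by apply: ereal_inf_lbound; exists N => /=.
Qed.

End concave_tail.

(** * Convex distortions *)

Section shift.
Context (R : realType) (d : measure_display) (T : measurableType d)
  (P : probability T R).
Implicit Types (X Y : {RV P >-> R}) (a x u : R).

Definition positive_shift X a : {RV P >-> R} := cutoff (X \+ cst a) 0.

Lemma positive_shiftE X a w : positive_shift X a w = Num.max (X w + a) 0.
Proof. by []. Qed.

Lemma positive_shift_ge0 X a w : 0 <= positive_shift X a w.
Proof. by rewrite positive_shiftE le_max lexx orbT. Qed.

Lemma quantile_positive_shift X a u : 0 < u < 1 ->
  quantile (positive_shift X a) u = Num.max (quantile X u + a) 0.
Proof.
move=> u01.
(* Two reals with the same upper bounds are equal, so [quantile_le] suffices. *)
have E x : (quantile (positive_shift X a) u <= x) =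
    (Num.max (quantile X u + a) 0 <= x).
  rewrite quantile_le// tail_cutoff ge_max -lerBrDr quantile_le// (leNgt 0).
  have -> : tail (X \+ cst a : {RV P >-> R}) x = tail X (x - a).
    rewrite /tail /ccdf /distribution /pushforward; congr (fine (P _)).
    by apply/seteqP; split => w /=; rewrite !in_itv/= !andbT ltrBlDr.
  case: ifP => _; last by rewrite andbT.
  by rewrite andbF; apply/negbTE; rewrite -ltNge; lra.
by apply/eqP; rewrite eq_le E lexx -E lexx.
Qed.

(** [in_LQ] sees only positive parts, so a bound suffices for the cone property. With m = max(q, 0),
    {aX > am} lies in {X > m}, also for a = 0. *)
Lemma quantile_scale_le X a u : 0 <= a -> 0 < u < 1 ->
  quantile (a \o* X : {RV P >-> R}) u <= a * Num.max (quantile X u) 0.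
Proof.
move=> a0 u01; rewrite quantile_le//.
apply: (@le_trans _ _ (tail X (Num.max (quantile X u) 0))).
  rewrite -lee_fin -!ccdfE /ccdf /distribution /pushforward.
  apply: le_measure; rewrite ?inE; [exact: measurable_funPTI..|].
  move=> w /=; rewrite !in_itv/= !andbT !(ltNge, mulrC a); apply: contra.
  by move=> h; rewrite ler_wpM2r.
apply: (le_trans (tail_noninc X (_ : quantile X u <= _))).
  by rewrite le_max lexx.
by rewrite -quantile_le.
Qed.

End shift.

(** * Risk under a convex distortion *)

Section convex_distortion.
Context (R : realType) (d : measure_display) (T : measurableType d)
  (P : probability T R) (D : R -> R) (Q : probability (measurableTypeR R) R).
Hypotheses (hD : distortion D) (hQ : corresponds Q D)
  (D_convex : forall x z y, 0 <= x -> x <= z -> z <= y -> y <= 1 ->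
    D z * (y - x) <= D x * (y - z) + D y * (z - x)).
Implicit Types (X Y Z : {RV P >-> R}) (a u : R).

Lemma risk_subadditive_ge0 X Y :
    (forall w, 0 <= X w) -> (forall w, 0 <= Y w) ->
  (quantile_risk Q ((X \+ Y)%R : {RV P >-> R}) <=
   quantile_risk Q X + quantile_risk Q Y)%E.
Proof.
move=> X0 Y0; have [_ Dmono Drc D0 _] := hD.
have XY0 w : 0 <= (X \+ Y)%R w by exact: addr_ge0.
rewrite /quantile_risk !(quantile_layer_cake hD hQ)//.
have := @concave_tail_subadditive _ _ _ P (fun p => 1 - D (1 - p)).
apply => //.
- by rewrite subr0 (distortion1 hD) subrr.
- move=> p q p0 pq q1; rewrite lerD2l lerN2; apply: Dmono; rewrite ?in_itv/=; lra.
- move=> x z y x0 xz zy y1.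
  have := @D_convex (1 - y) (1 - z) (1 - x); rewrite subr_ge0 !lerD2l !lerN2.
  rewrite gerDl oppr_le0 => /(_ y1 zy xz x0); lra.
(* Right-continuity of [D] at 1 - p becomes left-continuity at p. It is given on [0, 1[ only; for p
   = 0 the sequence is constant. *)
move=> p; rewrite le_eqVlt => /andP[/orP[/eqP <- _|p0 p1]].
  have max0 N : Num.max (0 - N.+1%:R^-1) 0 = 0 :> R.
    by apply/max_idPr; rewrite sub0r oppr_le0 invr_ge0.
  by under eq_fun do rewrite max0; exact: cvg_cst.
apply: cvgB; first exact: cvg_cst.
have /Drc/cvg_at_rightP : 1 - p \in `[0, 1[.
  by rewrite in_itv/= subr_ge0 p1/= ltrBlDr ltrDl.
apply; split=> [N|].
  by rewrite ltrD2l ltrN2 gt_max p0 andbT gtrBl invr_gt0.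
apply: cvgB; first exact: cvg_cst.
apply: (@squeeze_cvgr _ _ _ _ (fun N => p - N.+1%:R^-1) (cst p)).
- apply: nearW => N; rewrite le_max lexx/= ge_max (ltW p0) andbT gerBl.
  by rewrite invr_ge0.
- rewrite -[X in _ --> X]subr0; apply: cvgB; first exact: cvg_cst.
  exact: cvg_harmonic.
- exact: cvg_cst.
Qed.

(** (X + Y + 2a)^+ <= (X + a)^+ + (Y + a)^+, and quantiles are monotone. *)
Lemma shifted_risk_subadditive X Y a :
  (\int[Q]_(u in `]0%R, 1%R[)
     (Num.max (quantile (X \+ Y : {RV P >-> R})%R u + (a + a)) 0)%R%:E <=
   \int[Q]_(u in `]0%R, 1%R[) (Num.max (quantile X u + a) 0)%R%:E +
   \int[Q]_(u in `]0%R, 1%R[) (Num.max (quantile Y u + a) 0)%R%:E)%E.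
Proof.
have E Z b : (\int[Q]_(u in `]0%R, 1%R[) (Num.max (quantile Z u + b) 0)%R%:E =
    quantile_risk Q (positive_shift Z b))%E.
  apply: eq_integral => u; rewrite inE/= in_itv/= => u01.
  by rewrite quantile_positive_shift.
rewrite !E; apply: le_trans (risk_subadditive_ge0 _ _); [|exact: positive_shift_ge0..].
apply: ge0_le_integral => //.
- move=> u; rewrite /= in_itv/= => u01; rewrite lee_fin quantile_ge0//.
  exact: positive_shift_ge0.
- by apply/measurable_EFinP; exact: measurable_quantile.
- by apply/measurable_EFinP; exact: measurable_quantile.
move=> u; rewrite /= in_itv/= => u01; rewrite lee_fin quantile_mono// => w.
rewrite !positive_shiftE ge_max addrACA lerD ?le_max ?lexx//=.
by rewrite addr_ge0// le_max lexx orbT.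
Qed.

Local Notation I01 := (`]0%R, (1%R : R)[%classic).

Let risk_pos Z : \bar R := (\int[Q]_(u in I01) (Num.max (quantile Z u) 0)%:E)%E.
Let risk_neg Z : \bar R := (\int[Q]_(u in I01) (Num.max (- quantile Z u) 0)%:E)%E.
(** The cut at n keeps this finite, hence subtractable, even when [risk_neg] is infinite. *)
Let trunc_neg Z n : \bar R :=
  (\int[Q]_(u in I01) (Num.min (Num.max (- quantile Z u) 0) n%:R)%:E)%E.

Let measurable_neg Z : measurable_fun I01 (fun u => Num.max (- quantile Z u) 0).
Proof.
apply: measurable_maxr => //; apply: measurableT_comp => //.
exact: measurable_quantile.
Qed.

Let measurable_trunc Z n :
  measurable_fun I01 (fun u => Num.min (Num.max (- quantile Z u) 0) n%:R).
Proof. by apply: measurable_minr => //; exact: measurable_neg. Qed.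

Let trunc_ge0 Z n u : (0 <= (Num.min (Num.max (- quantile Z u) 0) n%:R)%:E)%E.
Proof. by rewrite lee_fin le_min le_max lexx orbT/=. Qed.

Let risk_cst (r : R) : (\int[Q]_(u in I01) r%:E = r%:E)%E.
Proof.
have [Q1 _] := hQ.
rewrite integral_cst; last exact: measurable_itv.
by rewrite -[RHS]mule1; congr (_ * _)%E; exact: Q1.
Qed.

Let trunc_neg_le_risk Z n : (trunc_neg Z n <= risk_neg Z)%E.
Proof.
apply: ge0_le_integral => //.
- by apply/measurable_EFinP; exact: measurable_trunc.
- by apply/measurable_EFinP; exact: measurable_neg.
- by move=> u _; rewrite lee_fin ge_min lexx.
Qed.

Let trunc_neg_fin Z n : trunc_neg Z n \is a fin_num.
Proof.
rewrite ge0_fin_numE; last by apply: integral_ge0 => u _; exact: trunc_ge0.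
apply: (@le_lt_trans _ _ n%:R%:E); last exact: ltry.
rewrite -[leRHS]risk_cst; apply: ge0_le_integral => //.
- by apply/measurable_EFinP; exact: measurable_trunc.
- by move=> u _; rewrite lee_fin ge_min lexx orbT.
Qed.

Let risk_pos_fin Z : in_LQ Q Z -> risk_pos Z \is a fin_num.
Proof.
move=> LZ; rewrite ge0_fin_numE//; apply: integral_ge0 => u _.
by rewrite lee_fin le_max lexx orbT.
Qed.

(** Pointwise, (q + n)^+ + min(q^-, n) = q^+ + n. *)
Let shifted_risk_trunc Z n : in_LQ Q Z ->
  (\int[Q]_(u in I01) (Num.max (quantile Z u + n%:R) 0)%:E =
   (risk_pos Z - trunc_neg Z n) + n%:R%:E)%E.
Proof.
move=> LZ; have mq := measurable_quantile Z.
have mpos : measurable_fun I01 (fun u => (Num.max (quantile Z u) 0)%:E).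
  by apply/measurable_EFinP/measurable_maxr.
have : (\int[Q]_(u in I01) (Num.max (quantile Z u + n%:R) 0)%:E + trunc_neg Z n =
    risk_pos Z + n%:R%:E)%E.
  rewrite -[X in (_ = _ + X)%E]risk_cst -!ge0_integralD//.
  - apply: eq_integral => u _; rewrite -!EFinD; congr EFin.
    have := ler0n R n; rewrite !maxEle !minEle.
    by do ! case: ifPn; rewrite -?ltNge; lra.
  - by move=> u _; rewrite lee_fin le_max lexx orbT.
  - by move=> u _; rewrite lee_fin le_max lexx orbT.
  - by apply/measurable_EFinP/measurable_maxr => //; exact: measurable_funD.
  - by apply/measurable_EFinP; exact: measurable_trunc.
by move=> E; rewrite addeAC -E addeK.
Qed.

Let risk_posneg Z : quantile_risk Q Z = (risk_pos Z - risk_neg Z)%E.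
Proof.
rewrite /quantile_risk integralE; congr (_ - _)%E; apply: eq_integral => u _.
  by rewrite funeposE EFin_max.
by rewrite funenegE EFin_max EFinN.
Qed.

Let cvg_trunc_neg Z : trunc_neg Z n @[n --> \oo] --> risk_neg Z.
Proof.
rewrite (_ : risk_neg Z = (\int[Q]_(u in I01)
   limn (fun n => (Num.min (Num.max (- quantile Z u) 0) n%:R)%:E))%E); last first.
  apply: eq_integral => u _; apply/esym/cvg_lim => //.
  apply: cvg_near_cst; near=> n; congr EFin; apply/min_idPl; near: n.
  exact: nbhs_infty_ger.
apply: cvg_monotone_convergence => //.
- by move=> n; apply/measurable_EFinP; exact: measurable_trunc.
- move=> u _ m n mn; rewrite lee_fin le_min ge_min lexx/=.
  by rewrite ge_min (ler_nat R m n) mn orbT.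
Unshelve. all: by end_near. Qed.

Lemma convex_distortion_cone : LQ_convex_cone P Q.
Proof.
split=> [X Y LX LY|a X a0 LX].
  apply: le_lt_trans (lte_add_pinfty LX LY).
  have := shifted_risk_subadditive X Y 0; rewrite addr0.
  under eq_integral do rewrite addr0.
  under [X in (_ <= X + _)%E -> _]eq_integral do rewrite addr0.
  by under [X in (_ <= _ + X)%E -> _]eq_integral do rewrite addr0.
have mpos (Z : {RV P >-> R}) :
    measurable_fun I01 (fun u => (Num.max (quantile Z u) 0)%:E).
  by apply/measurable_EFinP/measurable_maxr => //; exact: measurable_quantile.
have pos0 (Z : {RV P >-> R}) u : (0 <= (Num.max (quantile Z u) 0)%:E)%E.
  by rewrite lee_fin le_max lexx orbT.
apply: (@le_lt_trans _ _ (a%:E * risk_pos X)%E).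
  rewrite /risk_pos -ge0_integralZl//; last exact: mpos.
  apply: ge0_le_integral => //.
  - exact: mpos.
  - by apply: emeasurable_funM => //; exact: mpos.
  move=> u; rewrite /= in_itv/= => u01; rewrite -EFinM lee_fin ge_max.
  by rewrite quantile_scale_le//= mulr_ge0// le_max lexx orbT.
by rewrite -(fineK (risk_pos_fin LX)) -EFinM ltry.
Qed.

Lemma convex_distortion_subadditive : subadditive_risk P Q.
Proof.
move=> X Y LX LY LW; set W : {RV P >-> R} := (X \+ Y)%R.
(* Shifting [X] and [Y] by n and [W] by 2n makes the added constants cancel. *)
have bound n : (quantile_risk Q W <=
    (risk_pos X - trunc_neg X n) + (risk_pos Y - trunc_neg Y n))%E.
  apply: (@le_trans _ _ (risk_pos W - trunc_neg W (n + n))%E).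
    by rewrite risk_posneg leeB.
  have := shifted_risk_subadditive X Y n%:R.
  rewrite -natrD !shifted_risk_trunc// addeACA natrD EFinD leeD2rE//.
have cvgZ Z : in_LQ Q Z ->
    (risk_pos Z - trunc_neg Z n)%E @[n --> \oo] --> quantile_risk Q Z.
  move=> LZ; rewrite risk_posneg; apply: cvgeB.
  - by rewrite fin_num_adde_defr// risk_pos_fin.
  - exact: cvg_cst.
  - exact: cvg_trunc_neg.
(* Neither risk is +oo, so the sum of the limits is well defined even if one is -oo. *)
have lty Z : in_LQ Q Z -> (quantile_risk Q Z < +oo)%E.
  move=> LZ; rewrite risk_posneg -(fineK (risk_pos_fin LZ)).
  have : (0 <= risk_neg Z)%E.
    by apply: integral_ge0 => u _; rewrite lee_fin le_max lexx orbT.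
  by case: (risk_neg Z) => // r _; rewrite -EFinB ltry.
have cvgXY : ((risk_pos X - trunc_neg X n) + (risk_pos Y - trunc_neg Y n))%E
    @[n --> \oo] --> (quantile_risk Q X + quantile_risk Q Y)%E.
  apply: cvgeD; [|exact: cvgZ..].
  by apply: ltpinfty_adde_def; rewrite inE; exact: lty.
rewrite -(cvg_lim _ cvgXY)//; apply: lime_ge.
  by apply/cvg_ex; eexists; exact: cvgXY.
exact: nearW.
Qed.

End convex_distortion.

(** * From subadditivity to convexity *)

Lemma convex_functionP (R : realType) (D : R -> R) :
  @convex_function R R^o `[0, 1]%classic D <->
  forall t x y : R, 0 <= t <= 1 -> 0 <= x <= 1 -> 0 <= y <= 1 ->
    D (t * x + (1 - t) * y) <= t * D x + (1 - t) * D y.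
Proof.
split=> [Dcvx t x y /andP[t0 t1] x01 y01|Dcvx t x y].
  by have := Dcvx (Itv01 t0 t1) x y; rewrite !inE/= !in_itv/=; apply.
rewrite !inE/= !in_itv/= => x01 y01.
by apply: Dcvx => //; apply/andP.
Qed.

Lemma convex_function_chord (R : realType) (D : R -> R) :
  @convex_function R R^o `[0, 1]%classic D ->
  forall x z y, 0 <= x -> x <= z -> z <= y -> y <= 1 ->
    D z * (y - x) <= D x * (y - z) + D y * (z - x).
Proof.
move=> /convex_functionP Dcvx x z y x0 xz zy y1.
have [yx|xy] := leP y x.
  have -> : z = x by lra.
  have -> : y = x by lra.
  by rewrite subrr !mulr0 addr0.
have yx0 : 0 < y - x by rewrite subr_gt0.
have t0 : 0 <= (y - z) / (y - x) by rewrite divr_ge0 ?subr_ge0 ?(ltW xy).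
have t1 : (y - z) / (y - x) <= 1 by rewrite ler_pdivrMr// mul1r; lra.
have x01 : 0 <= x <= 1 by apply/andP; split; lra.
have y01 : 0 <= y <= 1 by apply/andP; split; lra.
have := Dcvx ((y - z) / (y - x)) x y; rewrite t0 t1 => /(_ isT x01 y01).
have -> : (y - z) / (y - x) * x + (1 - (y - z) / (y - x)) * y = z.
  by field; rewrite gt_eqF.
rewrite -(ler_pM2r yx0) => /le_trans; apply.
rewrite le_eqVlt; apply/orP; left; apply/eqP.
by field; rewrite gt_eqF.
Qed.

(** The gap [f] between [D] and its chord is again midpoint convex and bounded above by C; repeated
    halving gives 2^n f <= C for every n, hence f <= 0. *)
Lemma midpoint_convex_bounded (R : realType) (D : R -> R) (C : R) :
    (forall x, 0 <= x <= 1 -> 0 <= D x <= C) ->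
    (forall x y, 0 <= x <= 1 -> 0 <= y <= 1 ->
      2 * D ((x + y) / 2) <= D x + D y) ->
  @convex_function R R^o `[0, 1]%classic D.
Proof.
move=> D_bnd D_mid; apply/convex_functionP => t x y t01 x01 y01.
pose f s := D (s * x + (1 - s) * y) - (s * D x + (1 - s) * D y).
have in01 s : 0 <= s <= 1 -> 0 <= s * x + (1 - s) * y <= 1.
  by move=> s01; apply/andP; split; nra.
have f0 : f 0 = 0 by rewrite /f !mul0r subr0 !mul1r !add0r subrr.
have f1 : f 1 = 0 by rewrite /f subrr !mul0r !mul1r !addr0 subrr.
have f_mid a b : 0 <= a <= 1 -> 0 <= b <= 1 -> 2 * f ((a + b) / 2) <= f a + f b.
  move=> a01 b01; have := D_mid _ _ (in01 a a01) (in01 b b01).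
  rewrite (_ : (a * x + (1 - a) * y + (b * x + (1 - b) * y)) / 2 =
    (a + b) / 2 * x + (1 - (a + b) / 2) * y); last by field.
  by rewrite /f; lra.
(* Halving: s is the midpoint of 2s and 0, or of 2s - 1 and 1, and f vanishes
   at 0 and 1, so that any upper bound of f can be divided by 2. *)
have f_halve n s : 0 <= s <= 1 -> 2 ^+ n * f s <= C.
  elim: n s => [|n IH] s s01.
    rewrite expr0 mul1r /f; have /andP[_] := D_bnd _ (in01 s s01).
    have /andP[? _] := D_bnd _ x01; have /andP[? _] := D_bnd _ y01; nra.
  have [sh|sh] := leP s 2^-1.
    have := f_mid (2 * s) 0; rewrite f0 !addr0 (_ : 2 * s / 2 = s); last by field.
    have := IH (2 * s) ltac:(lra); have : 0 <= 2 ^+ n :> R by rewrite exprn_ge0.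
    move=> p0 h1 /(_ ltac:(lra) ltac:(lra)) h2; apply: le_trans h1.
    by rewrite exprSr -mulrA ler_wpM2l.
  have := f_mid (2 * s - 1) 1; rewrite f1 !addr0 subrK.
  rewrite (_ : 2 * s / 2 = s); last by field.
  have := IH (2 * s - 1) ltac:(lra); have : 0 <= 2 ^+ n :> R by rewrite exprn_ge0.
  move=> p0 h1 /(_ ltac:(lra) ltac:(lra)) h2; apply: le_trans h1.
  by rewrite exprSr -mulrA ler_wpM2l.
suff : f t <= 0 by rewrite /f subr_le0.
rewrite leNgt; apply/negP => ft0.
have C0 : 0 <= C by have /andP[? ?] := D_bnd _ x01; lra.
have [n nC] : exists n : nat, C / f t < n%:R.
  by exists (Num.bound (C / f t)); rewrite archi_boundP// divr_ge0// ltW.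
have := f_halve n _ t01; rewrite leNgt => /negP; apply.
move: nC; rewrite ltr_pdivrMr// => /lt_le_trans; apply.
by rewrite ler_pM2r// -natrX ler_nat ltnW// ltn_expl.
Qed.

Section subadditive_convex.
Context (R : realType) (d : measure_display) (T : measurableType d)
  (P : probability T R) (D : R -> R) (Q : probability (measurableTypeR R) R).
Hypotheses (hD : distortion D) (hQ : corresponds Q D).
Implicit Types (A : set T) (m x y : R).

Let integral_upper m : 0 <= m <= 1 ->
  (\int[Q]_(u in `]0%R, 1%R[) (\1_(`]m, 1%R[%classic : set R) u)%:E =
   (1 - D m)%:E)%E.
Proof.
move=> /[dup] m01 /andP[m0 m1].
rewrite integral_indic; [|exact: measurable_itv..].
rewrite -(Q_tail hD hQ)//; congr (Q _).
apply/seteqP; split=> u /=; rewrite !in_itv/=; first by case.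
by move=> /andP[mu u1]; rewrite mu u1 (le_lt_trans m0).
Qed.

(** An indicator of an event of probability 1 - m can be positive only at the top 1 - m of the
    levels. *)
Lemma quantile_indic A (mA : measurable A) m u : P A = (1 - m)%:E ->
  0 < u < 1 ->
  quantile (mindic R mA : {RV P >-> R}) u <= \1_(`]m, 1%R[%classic : set R) u.
Proof.
move=> PA u01; have /andP[u0 u1] := u01.
rewrite quantile_le// indicE mem_setE in_itv/= u1 andbT.
rewrite /tail /ccdf /distribution /pushforward; case: ltP => um/=.
  rewrite (_ : _ @^-1` _ = set0) ?measure0/=; first by lra.
  apply/seteqP; split => // w /=; rewrite in_itv/= andbT /mindic indicE.
  by case: (w \in A) => /=; rewrite ?ltxx// ltNge ler01.
rewrite (_ : _ @^-1` _ = A) ?PA/=; first by lra.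
apply/seteqP; split => w /=; rewrite in_itv/= andbT /mindic indicE.
  by case: (boolP (w \in A)) => [/set_mem//|_]; rewrite ltxx.
by move=> Aw; rewrite mem_set//= ltr01.
Qed.

Lemma indic_risk_le A (mA : measurable A) m : P A = (1 - m)%:E -> 0 <= m <= 1 ->
  in_LQ Q (mindic R mA : {RV P >-> R}) /\
  (quantile_risk Q (mindic R mA : {RV P >-> R}) <= (1 - D m)%:E)%E.
Proof.
move=> PA m01; set X : {RV P >-> R} := mindic R mA.
have X0 w : 0 <= X w by [].
have pos : (\int[Q]_(u in `]0%R, 1%R[) (Num.max (quantile X u) 0)%:E <=
    (1 - D m)%:E)%E.
  rewrite -integral_upper//; apply: ge0_le_integral => //.
  - by move=> u _; rewrite lee_fin le_max lexx orbT.
  - by apply/measurable_EFinP/measurable_maxr => //; exact: measurable_quantile.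
  - by apply/measurable_EFinP; exact: measurable_indic.
  - move=> u; rewrite /= in_itv/= => u01; rewrite lee_fin ge_max.
    by rewrite quantile_indic//= indicE.
split; first by apply: le_lt_trans pos _; exact: ltry.
apply: le_trans pos; rewrite le_eqVlt; apply/orP; left; apply/eqP.
apply: eq_integral => u; rewrite inE/= in_itv/= => u01.
by rewrite (max_idPl _)// quantile_ge0.
Qed.

Hypotheses (hP : supports_uniform P) (hsub : subadditive_risk P Q).

(** The two indicators have risk at most 1 - D m each, while their sum is at least 1 on {U > x} and
    2 on {U > y}, so its risk is at least (1 - D x) + (1 - D y). *)
Lemma subadditive_midpoint x y : 0 <= x <= 1 -> 0 <= y <= 1 ->
  2 * D ((x + y) / 2) <= D x + D y.
Proof.
wlog xy : x y / x <= y => [th x01 y01|].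
  by have [/th|/ltW/th] := leP x y; [|rewrite (addrC x) (addrC (D x))]; apply.
move=> /[dup] x01 /andP[x0 x1] /[dup] y01 /andP[y0 y1].
set m := (x + y) / 2.
have xm : x <= m by rewrite /m; lra.
have my : m <= y by rewrite /m; lra.
have m01 : 0 <= m <= 1 by apply/andP; split; lra.
have [U hU] := hP.
have PU s : 0 <= s <= 1 -> P (U @^-1` `]s, +oo[) = (1 - s)%:E.
  move=> s01; have := cdf_ccdf_1 U s; rewrite hU ?in_itv//.
  by move=> /(congr1 (fun z => z - s%:E)%E); rewrite addeAC subee// add0e EFinB.
have mU (B : set R) : measurable B -> measurable (U @^-1` B).
  by move=> mB; exact: measurable_funPTI.
(* The union of A and B is {U > x} and their intersection is {U > y}. *)
pose A := U @^-1` `]m, +oo[.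
pose B := U @^-1` `]x, m] `|` U @^-1` `]y, +oo[.
have mA : measurable A by exact: mU.
have mB : measurable B by apply: measurableU; exact: mU.
have PA : P A = (1 - m)%:E by exact: PU.
have Pxm : P (U @^-1` `]x, m]) = (m - x)%:E.
  have E : (P (U @^-1` `]x, m]) + P (U @^-1` `]m, +oo[) = (1 - x)%:E)%E.
    rewrite -PU// -measureU; [|exact: mU..|].
    - by rewrite -preimage_setU -itv_bndbnd_setU// bnd_simp.
    - apply/seteqP; split => // w /=; rewrite !in_itv/= andbT => -[/andP[_ h1] h2].
      by have := lt_le_trans h2 h1; rewrite ltxx.
  move: E; rewrite (PU m)// => /(congr1 (fun z => z - (1 - m)%:E)%E).
  by rewrite addeK// -EFinB => ->; congr EFin; lra.
(* The choice of m as midpoint enters here: (m - x) + (1 - y) = 1 - m. *)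
have PB : P B = (1 - m)%:E.
  rewrite measureU; [|exact: mU..|]; last first.
    apply/seteqP; split => // w /=; rewrite !in_itv/= andbT => -[/andP[_ h1] h2].
    by have := lt_le_trans h2 (le_trans h1 my); rewrite ltxx.
  transitivity ((m - x)%:E + (1 - y)%:E)%E.
    by congr (_ + _)%E; [exact: Pxm|exact: PU].
  by rewrite -EFinD; congr EFin; rewrite /m; lra.
pose X : {RV P >-> R} := mindic R mA; pose Y : {RV P >-> R} := mindic R mB.
have [LX rX] := indic_risk_le mA PA m01; have [LY rY] := indic_risk_le mB PB m01.
pose W : {RV P >-> R} := (X \+ Y)%R.
have W0 w : 0 <= W w by exact: addr_ge0.
have tW s t : 0 <= s <= 1 -> (forall w, s < U w -> t < W w) -> 1 - s <= tail W t.
  move=> s01 sub; rewrite -lee_fin -ccdfE -PU// /ccdf /distribution /pushforward.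
  apply: le_measure; rewrite ?inE; [exact: mU|exact: measurable_funPTI|].
  by move=> w /=; rewrite !in_itv/= !andbT; exact: sub.
have X1 w : m < U w -> X w = 1.
  by move=> mw; rewrite /X/= /mindic indicE mem_set// /A/= in_itv/= mw.
have Y1 w : y < U w \/ x < U w <= m -> Y w = 1.
  move=> h; rewrite /Y/= /mindic indicE mem_set//; case: h => h; [right|left].
    by rewrite /= in_itv/= h.
  by rewrite /= in_itv.
have WxU w : x < U w -> 1 <= W w.
  move=> xw; have [wm|mw] := leP (U w) m; last by rewrite /W/= X1// lerDl.
  by rewrite /W/= (@Y1 w) ?lerDr//; right; rewrite xw.
have WyU w : y < U w -> 2 <= W w.
  by move=> yw; rewrite /W/= X1 ?(le_lt_trans my)// Y1//; left.
have Wle w : W w <= 2.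
  by rewrite /W/= /X /Y /mindic !indicE; do 2 case: (_ \in _) => /=; lra.
(* [subadditive_risk] asks for this membership; it holds because [W] is bounded by 2. *)
have LW : in_LQ Q W.
  apply: (@le_lt_trans _ _ (\int[Q]_(u in `]0%R, 1%R[) (cst 2%:E) u)%E).
    apply: ge0_le_integral => //.
    - by move=> u _; rewrite lee_fin le_max lexx orbT.
    - by apply/measurable_EFinP/measurable_maxr => //; exact: measurable_quantile.
    move=> u; rewrite /= in_itv/= => u01; rewrite lee_fin ge_max ler0n andbT.
    rewrite quantile_le//; apply: (@le_trans _ _ 0); last by lra.
    rewrite /tail /ccdf /distribution /pushforward (_ : _ @^-1` _ = set0) ?measure0//.
    by apply/seteqP; split => // w /=; rewrite in_itv/= andbT ltNge Wle.
  rewrite integral_cst; last exact: measurable_itv.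
  apply: (@le_lt_trans _ _ (2%:E * 1)%E); last by rewrite mule1 ltry.
  by apply: lee_wpmul2l; [rewrite lee_fin|exact: probability_le1].
(* The quantile of [W] dominates the sum of the indicators of ]x, 1[ and ]y, 1[. *)
have rW : ((1 - D x)%:E + (1 - D y)%:E <= quantile_risk Q W)%E.
  rewrite -!integral_upper// -ge0_integralD//; last 2 first.
  - by apply/measurable_EFinP; exact: measurable_indic.
  - by apply/measurable_EFinP; exact: measurable_indic.
  apply: ge0_le_integral => //.
  - by move=> u _; rewrite -EFinD lee_fin addr_ge0.
  - by apply/measurable_EFinP/measurable_funD; exact: measurable_indic.
  - by apply/measurable_EFinP; exact: measurable_quantile.
  move=> u; rewrite /= in_itv/= => u01; rewrite -EFinD lee_fin !indicE !mem_setE.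
  have /andP[u0 u1] := u01; rewrite !in_itv/= u1 !andbT.
  have [xu|ux] := ltP x u; last first.
    by rewrite ltNge (le_trans ux xy)/= addr0 quantile_ge0.
  have [yu|uy] := ltP y u; apply: quantile_ge => // t t12.
    apply: (@lt_le_trans _ _ (1 - y)); first by lra.
    by apply: tW => // w yw; apply: lt_le_trans t12 _; rewrite WyU.
  apply: (@lt_le_trans _ _ (1 - x)); first by lra.
  by apply: tW => // w xw; apply: lt_le_trans t12 _; rewrite addr0 WxU.
have := le_trans rW (le_trans (hsub LX LY LW) (leeD rX rY)).
by rewrite -!EFinD lee_fin; lra.
Qed.

Lemma subadditive_convex_function : @convex_function R R^o `[0, 1]%classic D.
Proof.
apply: (@midpoint_convex_bounded _ _ 1); last exact: subadditive_midpoint.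
move=> x x01; have [D01 _ _ _ _] := hD.
by have := D01 x; rewrite !in_itv/=; apply.
Qed.

End subadditive_convex.

Unset Implicit Arguments.

Theorem theorem5p4 (R : realType) (d : measure_display)
    (T : measurableType d) (P : probability T R)
    (D : R -> R) (Q : probability (measurableTypeR R) R)
    (hD : distortion D) (hQ : corresponds Q D) :
  (@convex_function R R^o `[0, 1]%classic D ->
    LQ_convex_cone P Q /\ subadditive_risk P Q) /\
  (supports_uniform P ->
    (@convex_function R R^o `[0, 1]%classic D <-> subadditive_risk P Q) /\
    (subadditive_risk P Q <-> LQ_convex_cone P Q /\ subadditive_risk P Q)).
Proof.
(* From (a) to (c); (c) contains (b), and [ba] closes the cycle. *)
have ac : @convex_function R R^o `[0, 1]%classic D ->
    LQ_convex_cone P Q /\ subadditive_risk P Q.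
  move=> /convex_function_chord Dcvx; split.
    exact: convex_distortion_cone hD hQ Dcvx.
  exact: convex_distortion_subadditive hD hQ Dcvx.
split=> // hU; have ba := subadditive_convex_function hD hQ hU.
by split; [split=> [/ac[]|/ba]|split=> [/ba/ac|[]]].
Qed.
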